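(* Suppose $W$ is a set of non-zero arithmetic functions whose orders $v(f)$ $(f\in W)$ are multiplicatively independent (as a family indexed by $W$). Then $\operatorname{Exp}^*W$ is algebraically independent over $\mathbb{C}$.
   Context: $\mathbb{N}=\{1,2,3,\dots\}$. An arithmetic function is a function $f:\mathbb{N}\to\mathbb{C}$. $\mathcal{A}$ is the commutative $\mathbb{C}$-algebra (an integral domain) of arithmetic functions under pointwise addition and convolution $(f*g)(n)=\sum_{d\mid n}f(d)g(n/d)$; $\alpha\in\mathbb{C}$ is identified with the function $1\mapsto\alpha$, $n\mapsto 0$ for $n>1$. All products and powers are convolution products. For $f\ne 0$ the order $v(f)$ is the least $n\in\mathbb{N}$ with $f(n)\neq 0$, and $v(0)=\infty$. A family of positive integers is multiplicatively independent if for any finitely many members $a_1,\dots,a_n$ with distinct indices, $a_1^{k_1}\cdots a_n^{k_n}=1$ with $k_i\in\mathbb{Z}$ implies all $k_i=0$. $\|f\|=1/v(f)$ (with $1/\infty=0$) is a non-archimedean norm giving a topology on $\mathcal{A}$. If $f(1)=0$, $\operatorname{Exp}(f)=\sum_{k\ge0}f^k/k!$ (convergent in this topology); in general $\operatorname{Exp}(f)=\exp(f(1))*\operatorname{Exp}(f-f(1))$. Let $\mathcal{A}_{\mathbb{R}}=\{f:f(1)\in\mathbb{R}\}$ and $\mathcal{A}_+=\{f:f(1)\in\mathbb{R},\,f(1)>0\}$. $\operatorname{Exp}$ restricts to a group isomorphism $(\mathcal{A}_{\mathbb{R}},+)\to(\mathcal{A}_+,* )$ with inverse $\operatorname{Log}$.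 $\operatorname{Exp}^m$ denotes $m$-fold composition for $m\ge 0$ ($\operatorname{Exp}^0=\mathrm{id}$), and $\operatorname{Exp}^{-k}=\operatorname{Log}^k$ (where defined) for $k\ge1$. For each $f\in\mathcal{A}$ there is a largest $k\ge0$ such that $\operatorname{Log}^kf$ is defined. For nonempty $W\subseteq\mathcal{A}$, $k_W$ is the largest $k\ge0$ such that $\operatorname{Log}^{k}f$ is defined for every $f\in W$, and $\operatorname{Exp}^*W=\{\operatorname{Exp}^mf: f\in W,\ m\in\mathbb{Z},\ m\ge -k_W\}$. *)

(* Defs.v *)
From HB Require Import structures.
From mathcomp Require Import all_boot all_order all_algebra.
From mathcomp Require Import complex.
From mathcomp Require Import all_classical all_reals all_analysis.
(* The notations of mpoly clash with those of the analysis library. *)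
From mathcomp Require Import -(notations) mpoly.

Set Implicit Arguments.
Unset Strict Implicit.
Unset Printing Implicit Defensive.

Import Order.TTheory GRing.Theory Num.Theory.
Import numFieldNormedType.Exports.

Local Open Scope classical_set_scope.
Local Open Scope complex_scope.
Local Open Scope ring_scope.

Definition posnat := {n : nat | (0 < n)%N}.

Definition pone : posnat := exist _ 1%N isT.

(* [pn n] is [n] as a positive integer; the default value [pn 0 = 1] is never
   used below. *)
Definition pn (n : nat) : posnat := insubd pone n.

(* A record rather than a function type, so that neither the pointwise product
   nor the product topology of function types applies to it. *)
Record arith (R : realType) := Arith { arith_fun :> posnat -> R[i] }.

HB.instance Definition _ (R : realType) := gen_eqMixin (arith R).
HB.instance Definition _ (R : realType) := gen_choiceMixin (arith R).

Lemma pnK (n : nat) : (0 < n)%N -> val (pn n) = n.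
Proof. by move=> n0; rewrite val_insubd n0. Qed.

Lemma pn_val (n : posnat) : pn (val n) = n.
Proof. by rewrite /pn valKd. Qed.

Section ArithAlgebra.
Context {R : realType}.
Implicit Types f g h : arith R.

Lemma arithP f g : (forall n, f n = g n) -> f = g.
Proof. by case: f => f; case: g => g /= fg; congr Arith; apply/funext. Qed.

Definition arith_zero := Arith (fun=> (0 : R[i])).
Definition arith_opp f := Arith (fun n => - f n).
Definition arith_add f g := Arith (fun n => f n + g n).

Fact arith_addA : associative arith_add.
Proof. by move=> f g h; apply: arithP => n /=; rewrite addrA. Qed.
Fact arith_addC : commutative arith_add.
Proof. by move=> f g; apply: arithP => n /=; rewrite addrC. Qed.
Fact arith_add0 : left_id arith_zero arith_add.
Proof. by move=> f; apply: arithP => n /=; rewrite add0r. Qed.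
Fact arith_addN : left_inverse arith_zero arith_opp arith_add.
Proof. by move=> f; apply: arithP => n /=; rewrite addNr. Qed.

HB.instance Definition _ := GRing.isZmodule.Build (arith R)
  arith_addA arith_addC arith_add0 arith_addN.

Lemma arith0E n : (0 : arith R) n = 0. Proof. by []. Qed.
Lemma arithDE f g n : (f + g) n = f n + g n. Proof. by []. Qed.
Lemma arithNE f n : (- f) n = - f n. Proof. by []. Qed.
Lemma arithBE f g n : (f - g) n = f n - g n. Proof. by []. Qed.

Definition arith_one := Arith (fun n => (n == pone)%:R : R[i]).

Definition dconv f g := Arith (fun n =>
  \sum_(d <- divisors (val n)) f (pn d) * g (pn (val n %/ d)%N)).

Fact dconvC : commutative dconv.
Proof.
move=> f g; apply: arithP => -[n n0] /=.
have inj : {in divisors n &, injective (fun d => n %/ d)%N}.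
  move=> d e; rewrite -!dvdn_divisors // => dn en de.
  have d0 : (0 < n %/ d)%N by rewrite divn_gt0 ?(dvdn_gt0 n0) // dvdn_leq.
  apply/eqP; rewrite -(eqn_pmul2l d0) {2}de.
  by rewrite !divnK.
have pm : perm_eq [seq (n %/ d)%N | d <- divisors n] (divisors n).
  apply: uniq_perm; rewrite ?divisors_uniq // ?map_inj_in_uniq ?divisors_uniq //.
  move=> e; apply/mapP/idP => [[d + ->]|].
    rewrite -!dvdn_divisors // => dn.
    by apply/dvdnP; exists d; rewrite mulnC divnK.
  rewrite -dvdn_divisors // => en; exists (n %/ e)%N.
    by rewrite -dvdn_divisors //; apply/dvdnP; exists e; rewrite mulnC divnK.
  by rewrite divnA // mulKn.
rewrite -(perm_big _ pm) big_map big_seq [RHS]big_seq.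
apply: eq_bigr => d; rewrite -dvdn_divisors // => dn.
by rewrite mulrC divnA // mulKn.
Qed.

Fact dconvA : associative dconv.
Proof.
move=> f g h; apply: arithP => -[n n0] /=.
pose F e d := f (pn e) * g (pn (d %/ e)%N) * h (pn (n %/ d)%N).
transitivity (\sum_(e <- divisors n) \sum_(d <- divisors n | (e %| d)%N) F e d).
  rewrite big_seq [RHS]big_seq; apply: eq_bigr => e.
  rewrite -dvdn_divisors // => en.
  have e0 := dvdn_gt0 n0 en.
  have ne0 : (0 < n %/ e)%N by rewrite divn_gt0 // dvdn_leq.
  have pm : perm_eq [seq d <- divisors n | (e %| d)%N]
                    [seq (e * c)%N | c <- divisors (n %/ e)].
    apply: uniq_perm; first by rewrite filter_uniq ?divisors_uniq.
      rewrite map_inj_in_uniq ?divisors_uniq // => c c' _ _ /eqP.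
      by rewrite eqn_pmul2l // => /eqP.
    move=> d; rewrite mem_filter -dvdn_divisors //.
    apply/andP/mapP => [[/dvdnP[c ->]] cn|[c + ->]].
      exists c; last by rewrite mulnC.
      by rewrite -dvdn_divisors // dvdn_divRL.
    rewrite -dvdn_divisors // dvdn_divRL // => cn.
    by rewrite dvdn_mulr // mulnC.
  rewrite -[RHS]big_filter (perm_big _ pm) big_map /= pnK // mulr_sumr.
  apply: eq_bigr => c _.
  by rewrite /F mulKn // mulrA divnMA.
rewrite (exchange_big_dep xpredT) //= big_seq [RHS]big_seq.
apply: eq_bigr => d; rewrite -dvdn_divisors // => dn.
have d0 := dvdn_gt0 n0 dn.
rewrite pnK // mulr_suml -[LHS]big_filter.
have pm : perm_eq [seq e <- divisors n | (e %| d)%N] (divisors d).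
  apply: uniq_perm; rewrite ?filter_uniq ?divisors_uniq // => e.
  rewrite mem_filter -!dvdn_divisors //.
  by case ed: (e %| d)%N => //=; rewrite (dvdn_trans ed).
by rewrite (perm_big _ pm).
Qed.

Fact dconv1 : left_id arith_one dconv.
Proof.
move=> f; apply: arithP => -[n n0] /=.
have n1 : 1%N \in divisors n by rewrite -dvdn_divisors // dvd1n.
rewrite (bigD1_seq 1%N) ?divisors_uniq //= big_seq_cond big1 => [|d].
  by rewrite -[pn 1]/(pn (val pone)) pn_val eqxx mul1r divn1 addr0
             -[n in LHS]/(val (exist (fun n => is_true (0 < n)%N) n n0)) pn_val.
rewrite -dvdn_divisors // => /andP[dn d1].
rewrite -val_eqE /= pnK ?(dvdn_gt0 n0) //.
by rewrite (negbTE d1) mul0r.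
Qed.

Fact dconvDl : left_distributive dconv +%R.
Proof.
move=> f g h; apply: arithP => n /=; rewrite -big_split.
by apply: eq_bigr => d _; rewrite /= mulrDl.
Qed.

Fact arith_one_neq0 : arith_one != 0.
Proof. by apply/eqP => /(congr1 (fun f : arith R => f pone)) /eqP; rewrite /= oner_eq0. Qed.

HB.instance Definition _ := GRing.Zmodule_isComNzRing.Build (arith R)
  dconvA dconvC dconv1 dconvDl arith_one_neq0.

Definition arith_scale (a : R[i]) f := Arith (fun n => a * f n).

Fact arith_scaleA a b f : arith_scale a (arith_scale b f) = arith_scale (a * b) f.
Proof. by apply: arithP => n /=; rewrite mulrA. Qed.
Fact arith_scale1 : left_id 1 arith_scale.
Proof. by move=> f; apply: arithP => n /=; rewrite mul1r. Qed.
Fact arith_scaleDr : right_distributive arith_scale +%R.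
Proof. by move=> a f g; apply: arithP => n /=; rewrite mulrDr. Qed.
Fact arith_scaleDl f : {morph arith_scale^~ f : a b / a + b}.
Proof. by move=> a b; apply: arithP => n /=; rewrite mulrDl. Qed.

HB.instance Definition _ := GRing.Zmodule_isLmodule.Build R[i] (arith R)
  arith_scaleA arith_scale1 arith_scaleDr arith_scaleDl.

Fact arith_scaleAl (a : R[i]) f g : a *: (f * g) = (a *: f) * g.
Proof.
by apply: arithP => n /=; rewrite mulr_sumr; apply: eq_bigr => d _; rewrite mulrA.
Qed.

HB.instance Definition _ :=
  GRing.Lmodule_isLalgebra.Build R[i] (arith R) arith_scaleAl.
HB.instance Definition _ := GRing.Lalgebra_isComAlgebra.Build R[i] (arith R).

Lemma arith1E n : (1 : arith R) n = (n == pone)%:R. Proof. by []. Qed.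
Lemma arithZE (a : R[i]) f n : (a *: f) n = a * f n. Proof. by []. Qed.
Lemma arithME f g n : (f * g) n =
  \sum_(d <- divisors (val n)) f (pn d) * g (pn (val n %/ d)%N).
Proof. by []. Qed.

End ArithAlgebra.

Section Topology.
Context {R : realType}.
Implicit Types f g h : arith R.

Definition nonzero_at f (n : nat) := (0 < n)%N && (f (pn n) != 0).

(* The order v(f); the value 0 stands for v(0) = oo, so that 1 / v(0) = 0 by 0^-1 = 0. *)
Definition vorder f : nat :=
  if pselect (exists n, nonzero_at f n) is left h then ex_minn h else 0%N.

Definition anorm f : R := (vorder f)%:R^-1.

Variant vorder_spec f : nat -> Type :=
| OrderZero of f = 0 : vorder_spec f 0%N
| OrderPos n of (0 < n)%N & f (pn n) != 0
    & (forall m, (0 < m < n)%N -> f (pn m) = 0) : vorder_spec f n.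

Lemma vorderP f : vorder_spec f (vorder f).
Proof.
rewrite /vorder; case: pselect => [ex|nex].
  case: ex_minnP => n /andP[n0 fn] nmin; apply: OrderPos => // m /andP[m0 mn].
  apply/eqP/negP => /negP fm; have := nmin m.
  by rewrite /nonzero_at m0 fm => /(_ isT); rewrite leqNgt mn.
apply: OrderZero; apply: arithP => n; apply/eqP/negP => /negP fn; apply: nex.
by exists (val n); rewrite /nonzero_at (valP n) pn_val.
Qed.

Lemma vorder0 : vorder (0 : arith R) = 0%N.
Proof. by case: vorderP => // n _; rewrite eqxx. Qed.

Lemma vorder_eq0 f : (vorder f == 0%N) = (f == 0).
Proof.
case: vorderP => [->|[]// n _ fn _]; first by rewrite !eqxx.
by apply/esym/eqP => f0; rewrite f0 eqxx in fn.
Qed.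

Lemma vorderN f : vorder (- f) = vorder f.
Proof.
suff E : nonzero_at (- f) = nonzero_at f by rewrite /vorder E.
by apply/funext => n; rewrite /nonzero_at arithNE oppr_eq0.
Qed.

Lemma anorm_ultra f g : anorm (f + g) <= Num.max (anorm f) (anorm g).
Proof.
have [fg0|fg0] := eqVneq (f + g) 0.
  by rewrite /anorm fg0 vorder0 invr0 le_max invr_ge0 ler0n.
rewrite /anorm; case: (vorderP (f + g)) fg0 => [->|n n0 fgn _ _].
  by rewrite eqxx.
have le_inv (u : arith R) : u (pn n) != 0 -> (n%:R^-1 : R) <= (vorder u)%:R^-1.
  case: vorderP => [->|m m0 _ um un]; first by rewrite eqxx.
  rewrite lef_pV2 ?posrE ?ltr0n // ler_nat leqNgt; apply/negP => nm.
  by move: un; rewrite um ?eqxx // n0.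
rewrite le_max; have [f0|f0] := eqVneq (f (pn n)) 0; last by rewrite le_inv.
by rewrite [X in _ || X]le_inv ?orbT //; move: fgn; rewrite arithDE f0 add0r.
Qed.

Definition adist f g : R := anorm (f - g).

Fact adistxx f : adist f f = 0.
Proof. by rewrite /adist /anorm subrr vorder0 invr0. Qed.

Fact adist_positivity f g : adist f g = 0 -> f = g.
Proof.
rewrite /adist /anorm => /eqP; rewrite invr_eq0 pnatr_eq0 vorder_eq0 subr_eq0.
by move/eqP.
Qed.

Fact adist_sym f g : adist f g = adist g f.
Proof. by rewrite /adist /anorm -opprB vorderN. Qed.

Fact adist_triangle g f h : adist f h <= adist f g + adist g h.
Proof.
rewrite /adist -[f - h](subrKA g) (le_trans (anorm_ultra _ _)) // ge_max.
by rewrite lerDl lerDr !invr_ge0 !ler0n.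
Qed.

HB.instance Definition _ := isPointed.Build (arith R) 0.
HB.instance Definition _ := isMetric.Build R (arith R)
  adistxx adist_positivity adist_sym adist_triangle.

End Topology.

Section ExpLog.
Context {R : realType}.
Implicit Types (f g : arith R) (W : set (arith R)).

(* The exponential of a complex number, by Euler's formula. *)
Definition cexp (z : R[i]) : R[i] :=
  (expR (complex.Re z))%:C * (cos (complex.Im z) +i* sin (complex.Im z)).

(* The limit is taken in the metric space of arithmetic functions; when
   [f pone = 0] the factor [cexp (f pone)] is 1. *)
Definition Exp f : arith R :=
  cexp (f pone) *:
    limn (series (fun k => (k`!%:R^-1 : R[i]) *: (f - (f pone)%:A) ^+ k)).

Definition arith_real : set (arith R) := [set f | f pone \is Num.real].

(* In the partial order of [R[i]], [0 < z] says that [z] is real and positive. *)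
Definition arith_pos : set (arith R) := [set f | 0 < f pone].

(* The inverse of [Exp] from [arith_real] onto [arith_pos]; a default value
   outside [arith_pos]. *)
Definition Log f : arith R := xget 0 [set g | arith_real g /\ Exp g = f].

Definition Log_defined (k : nat) f : Prop :=
  forall j, (j < k)%N -> arith_pos (iter j Log f).

Definition iterExp (m : int) f : arith R :=
  match m with
  | Posz n => iter n Exp f
  | Negz n => iter n.+1 Log f
  end.

Definition all_Log_defined W (k : nat) : Prop := forall f, W f -> Log_defined k f.

(* The largest [k] such that [all_Log_defined W k]; meaningful for nonempty
   [W]. *)
Definition kmax W : nat :=
  xget 0%N [set k | all_Log_defined W k /\
                    forall j, all_Log_defined W j -> (j <= k)%N].

Definition Expstar W : set (arith R) :=
  [set g | exists (f : arith R) (m : int),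
     [/\ W f, - (kmax W)%:Z <= m & g = iterExp m f]].

End ExpLog.

(* The family of positive integers [a i], for [i] in [D]; the products are taken
   in [rat] because exponents may be negative. *)
Definition mult_indep (I : Type) (D : set I) (a : I -> nat) : Prop :=
  forall (n : nat) (x : 'I_n -> I) (k : 'I_n -> int),
    injective x -> (forall j, D (x j)) ->
    \prod_(j < n) ((a (x j))%:R : rat) ^ k j = 1 -> forall j, k j = 0.

Definition alg_indep (K : fieldType) (A : comAlgType K) (S : set A) : Prop :=
  forall (n : nat) (x : 'I_n -> A) (p : mpoly n K),
    injective x -> (forall j, S (x j)) ->
    mmap (GRing.in_alg A) x p = 0 -> p = 0.

(* Main.v *)
Require Import Defs.
From HB Require Import structures.
From mathcomp Require Import all_boot all_order all_algebra.
From mathcomp Require Import fingroup perm.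
From mathcomp Require Import complex.
From mathcomp Require Import all_classical all_reals all_analysis.
From mathcomp Require Import -(notations) mpoly.
From mathcomp Require Import zify ring.

Set Implicit Arguments.
Unset Strict Implicit.
Unset Printing Implicit Defensive.

Import Order.TTheory GRing.Theory Num.Theory.

Local Open Scope ring_scope.

(** An order equal to 1 would be a nontrivial multiplicative relation, so every
    [f] in [W] has [f pone = 0], no logarithm of [f] is defined, and the set in
    question consists of the iterates [f, Exp f, Exp (Exp f), ...] of the
    members of [W].

    Finitely many [f_1, ..., f_N] in [W] are separated by derivations. For a
    completely additive weight [w] (such as the [p]-adic valuation),
    multiplying [f n] by [w n] is a derivation of the convolution algebra, and
    it maps [Exp f] to the product of [Exp f] by its value at [f]. Independence
    of the orders [v(f_i)] provides weights [w_1, ..., w_N] that are dual to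
    them ([dual_weights]); comparing leading coefficients, the Jacobian matrix
    of the [f_i] for these weights has nonzero determinant, because its leading
    coefficient is the product of those of the [f_i]. A combination of the
    weight derivations with cofactors as coefficients then gives, for each [i],
    a derivation that is compatible with [Exp], kills all [f_j] with [j != i]
    and does not kill [f_i] ([dual_derivations]).

    It remains to see that [z_0 = f_i, z_1 = Exp z_0, z_2 = Exp z_1, ...] are
    successively transcendental over any ring of constants of this derivation
    [D] ([transcendental_tower]). This is a special case of Ax's theorem on
    exponentials with a direct proof. In a relation of minimal degree [d] for
    [z_(n+1)], with leading coefficient [a] and constant term [b], the fraction
    [b / a] has logarithmic derivative [d * D z_n] ([transcendental_exp]). But
    [a] and [b] are polynomials in [z_n], which is transcendental over the
    previous ring, and the degree in [z_n] of the logarithmic derivative of a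
    fraction is too small for that ([no_logderiv_adjoin]).

    Taking the towers over [f_1], over [f_2], and so on, one after the other,
    the rings generated form a filtration in which each new element is
    transcendental over the previous ones, which is algebraic independence
    ([alg_indep_filtration]). *)

(** * Adjoining elements to a subring *)

Section Transcendence.
Variable A : comNzRingType.
Implicit Types (S : {pred A}) (x y : A) (z : nat -> A).

Definition transcendental S x :=
  forall p : {poly A}, p \is a polyOver S -> p.[x] = 0 -> p = 0.

Definition adjoin S x : {pred A} :=
  fun y => `[< exists2 p, p \is a polyOver S & y = p.[x] >].

Lemma adjoinP S x y :
  reflect (exists2 p, p \is a polyOver S & y = p.[x]) (y \in adjoin S x).
Proof. exact: asboolP. Qed.

Fact adjoin_closed (S : subringClosed A) x : subring_closed (adjoin S x).
Proof.
split=> [|_ _ /adjoinP[p pS ->] /adjoinP[q qS ->]|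
         _ _ /adjoinP[p pS ->] /adjoinP[q qS ->]]; apply/adjoinP.
- by exists 1; rewrite ?rpred1 // hornerC.
- by exists (p - q); rewrite ?rpredB // hornerD hornerN.
- by exists (p * q); rewrite ?rpredM // hornerM.
Qed.

HB.instance Definition _ (S : subringClosed A) x :=
  GRing.isSubringClosed.Build A (adjoin S x) (adjoin_closed S x).

(** The ring generated over [S] by [z 0, ..., z n.-1]. *)
Fixpoint chain (S : subringClosed A) z n : subringClosed A :=
  if n is m.+1 then adjoin (chain S z m) (z m) : subringClosed A else S.

Lemma mem_adjoin (S : subringClosed A) x : x \in adjoin S x.
Proof. by apply/adjoinP; exists 'X; rewrite ?polyOverX ?hornerX. Qed.

Lemma sub_adjoin (S : subringClosed A) x : {subset S <= adjoin S x}.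
Proof.
by move=> a aS; apply/adjoinP; exists a%:P; rewrite ?polyOverC ?hornerC.
Qed.

Lemma mem_chain (S : subringClosed A) z n : z n \in chain S z n.+1.
Proof. exact: mem_adjoin. Qed.

Lemma sub_chain (S : subringClosed A) z m n :
  (m <= n)%N -> {subset chain S z m <= chain S z n}.
Proof.
move=> /subnK <-; elim: (n - m)%N => // k IH a aS.
exact/sub_adjoin/IH.
Qed.

Lemma chainD (S : subringClosed A) z m n :
  chain S z (m + n) = chain (chain S z m) (fun i => z (m + i)%N) n.
Proof. by elim: n => [|n IH]; rewrite ?addn0 // addnS /= IH. Qed.

Lemma eq_chain (S : subringClosed A) z z' n :
  (forall i, (i < n)%N -> z i = z' i) -> chain S z n = chain S z' n.
Proof.
elim: n => //= n IH eqz; rewrite eqz // IH // => i /ltnW; exact: eqz.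
Qed.

End Transcendence.

(** * Algebraic independence along a filtration *)

Section Scalars.
Variables (K : fieldType) (A : comAlgType K).

Definition scalars : {pred A} := fun a => `[< exists c : K, a = c%:A >].

Lemma scalarsP a : reflect (exists c : K, a = c%:A) (a \in scalars).
Proof. exact: asboolP. Qed.

Fact scalars_closed : subring_closed scalars.
Proof.
split=> [|_ _ /scalarsP[c ->] /scalarsP[d ->]|_ _ /scalarsP[c ->] /scalarsP[d ->]];
  apply/scalarsP.
- by exists 1; rewrite scale1r.
- by exists (c - d); rewrite scalerBl.
- by exists (c * d); rewrite -scalerAl mul1r scalerA.
Qed.

HB.instance Definition _ := GRing.isSubringClosed.Build A scalars scalars_closed.

End Scalars.

Section Criterion.
Variables (K : fieldType) (A : comAlgType K) (S : nat -> subringClosed A).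
Hypotheses (S_scalar : forall t (c : K), c%:A \in S t).
Hypotheses (S_mono : forall t, {subset S t <= S t.+1}).

(** The [x i] come in any order, sorted by the ranks [r i]. A relation is
    unwound by going down the ranks: once the exponents of all variables of
    rank above [t] have been fixed, the partial sum of the relation is a
    polynomial in the variable of rank [t] with coefficients in [S t], so
    fixing also the exponent of that variable still leaves a vanishing sum. At
    rank 0 a single coefficient of [p] remains. *)
Lemma alg_indep_filtration n (x : 'I_n -> A) (r : 'I_n -> nat) (p : mpoly n K) :
    injective r -> (forall i, x i \in S (r i).+1) ->
    (forall i, transcendental (S (r i)) (x i)) ->
  mmap (GRing.in_alg A) x p = 0 -> p = 0.
Proof.
move=> r_inj xS xtr px.
have S_le s t : (s <= t)%N -> {subset S s <= S t}.
  by move=> /subnK <-; elim: (t - s)%N => // k IH a aS; apply/S_mono/IH.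
(* [F t e] is the part of the relation where the exponents agree with [e] at
   all ranks from [t] on, divided by the powers of these variables. *)
pose agree t (e m : multinom n) := [forall i, (t <= r i)%N ==> (m i == e i)].
pose c t m := (mcoeff m p)%:A * \prod_(i < n | (r i < t)%N) x i ^+ m i.
have cS t m : c t m \in S t.
  rewrite rpredM ?S_scalar // rpred_prod // => i ri.
  exact/rpredX/(S_le _ _ ri)/xS.
pose F t e := \sum_(m <- msupp p | agree t e m) c t m.
have FS t : (forall e, F t.+1 e = 0) -> forall e, F t e = 0.
  move=> F0 e; have [/existsP[i0 /eqP ri0]|] := boolP [exists i, r i == t]; last first.
    rewrite negb_exists => /forallP rt; rewrite -[RHS](F0 e).
    have tE i : (t < r i)%N = (t <= r i)%N by rewrite ltn_neqAle eq_sym rt.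
    apply: eq_big => m; first by apply: eq_forallb => i; rewrite tE.
    move=> _; congr (_ * _); apply: eq_bigl => i.
    by rewrite [in RHS]ltnS [in RHS]leq_eqVlt (negbTE (rt i)).
  pose q := \sum_(m <- msupp p | agree t.+1 e m) c t m *: 'X^(m i0).
  have /(congr1 (fun q : {poly A} => q`_(e i0))) : q = 0.
    apply: (xtr i0); rewrite ?ri0.
      by apply: rpred_sum => m _; rewrite polyOverZ ?polyOverXn.
    rewrite -[RHS](F0 e) horner_sum; apply: eq_bigr => m _.
    rewrite hornerZ hornerXn /c -mulrA; congr (_ * _).
    rewrite [in RHS](bigD1 i0) ?ri0 //= mulrC; congr (_ * _).
    by apply: eq_bigl => i; rewrite -(inj_eq r_inj) ri0 ltnS ltn_neqAle andbC.
  rewrite coef_sum coef0 => <-; rewrite [RHS]big_mkcond /F [LHS]big_mkcond.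
  apply: eq_bigr => m _; rewrite coefZ coefXn.
  have -> : agree t e m = agree t.+1 e m && (e i0 == m i0).
    apply/forallP/andP => [me|[/forallP me /eqP ei] i].
      split; last by have := me i0; rewrite ri0 leqnn eq_sym.
      by apply/forallP => i; apply/implyP => /ltnW ti; exact: (implyP (me i)).
    apply/implyP; rewrite leq_eqVlt => /orP[|ti]; last exact: (implyP (me i)).
    by rewrite -ri0 (inj_eq r_inj) => /eqP <-; rewrite ei.
  by case: (agree t.+1 e m) => //=; case: eqP; rewrite ?mulr1 ?mulr0.
pose T := (\max_i r i).+1.
have rT i : (r i < T)%N by rewrite ltnS leq_bigmax.
have FT k : forall e, F (T - k)%N e = 0.
  elim: k => [|k IH] e.
    rewrite subn0 -px /mmap /F; apply: congr_big => // m.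
      by apply/forallP => i; rewrite leqNgt rT.
    by move=> _; congr (_ * _); apply: eq_bigl => i; rewrite rT.
  have [kT|Tk] := ltnP k T; first by apply: FS; rewrite subnSK.
  by have -> : (T - k.+1 = T - k)%N by lia.
apply/mpolyP => e; rewrite mcoeff0; have [ep|/memN_msupp_eq0//] := boolP (e \in msupp p).
have agree0 m : agree 0%N e m = (m == e).
  by apply/forallP/eqP => [me|-> i]; [apply/mnmP => i; exact/eqP/me | apply/implyP].
have := FT T e; rewrite subnn /F (eq_bigl _ _ agree0) -big_filter.
rewrite (filter_pred1_uniq (msupp_uniq p) ep) big_seq1.
rewrite /c big_pred0 ?mulr1 => [/eqP|//].
by rewrite (fmorph_eq0 (GRing.in_alg A)) => /eqP.
Qed.

End Criterion.

(** * Derivations *)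

Section Derivations.
Variable A : comNzRingType.
Implicit Types (x y : A) (p : {poly A}).

Definition derivation (D : A -> A) :=
  {morph D : x y / x + y} /\ forall x y, D (x * y) = D x * y + x * D y.

Variable D : A -> A.
Hypothesis derD : derivation D.

Lemma derivation0 : D 0 = 0.
Proof. by apply: (addrI (D 0)); rewrite -derD.1 !addr0. Qed.

Lemma derivation_opp x : D (- x) = - D x.
Proof. by apply/eqP; rewrite -addr_eq0 -derD.1 addNr derivation0. Qed.

Lemma derivation_horner p x :
  D p.[x] = (map_poly D p).[x] + p^`().[x] * D x.
Proof.
elim/poly_ind: p => [|p c IH].
  by rewrite deriv0 map_poly0 !horner0 mul0r addr0 derivation0.
have -> : map_poly D (p * 'X + c%:P) = map_poly D p * 'X + (D c)%:P.
  apply/polyP => i; rewrite coef_map_id0 ?derivation0 // !coefD !coefMX !coefC.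
  rewrite derD.1; case: i => [|i] /=; rewrite ?derivation0 //.
  by rewrite coef_map_id0 ?derivation0.
rewrite !poly.derivE !hornerE derD.1 derD.2 IH; ring.
Qed.

Lemma chain_constants (S : subringClosed A) z n :
    {in S, forall s, D s = 0} ->
    (forall i, (i < n)%N -> D (z i) = 0) ->
  {in chain S z n, forall s, D s = 0}.
Proof.
move=> DS; elim: n => //= n IH Dz _ /adjoinP[p /polyOverP pS ->].
rewrite derivation_horner // Dz // mulr0 addr0.
suff -> : map_poly D p = 0 by rewrite horner0.
apply/polyP => i; rewrite coef_map_id0 ?derivation0 // coef0.
by apply: IH => // j /ltnW; exact: Dz.
Qed.

End Derivations.

(** * Towers of exponentials over a ring of constants *)

Section Tower.
Variables (A : idomainType) (D : A -> A).
Hypotheses (A_pchar0 : [pchar A] =i pred0) (derD : derivation D).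
Implicit Types (S : subringClosed A) (p q P Q V : {poly A}) (x y w : A) (z : nat -> A).

Let natA_neq0 n : n.+1%:R != 0 :> A.
Proof. by rewrite (pcharf0P _).1. Qed.

(** Applying [D] to a relation with constant coefficients and cancelling [D x]
    gives the formal derivative as a relation of lower degree; so in
    characteristic 0 a relation of least degree is a constant, hence 0. *)
Lemma transcendental_constants S x :
  {in S, forall s, D s = 0} -> D x != 0 -> transcendental S x.
Proof.
move=> DS Dx p; have [n] := ubnP (size p); elim: n p => // n IH p szp pS px.
have Dp0 : map_poly D p = 0.
  apply/polyP => i; rewrite coef_map_id0 ?(derivation0 derD) // coef0 DS //.
  exact: polyOverP.
have p'0 : p^`() = 0.
  have [->|p0] := eqVneq p 0; first exact: deriv0.
  apply: IH; rewrite ?polyOver_deriv //.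
    by rewrite (leq_trans _ (_ : size p <= n)%N) ?lt_size_deriv.
  apply/eqP; have := derivation_horner derD p x.
  rewrite px (derivation0 derD) Dp0 horner0 add0r => /esym/eqP.
  by rewrite mulf_eq0 (negbTE Dx) orbF.
have pC : p = (p`_0)%:P.
  apply/polyP => -[|i]; rewrite coefC //=; apply/eqP.
  have /eqP := congr1 (fun q : {poly A} => q`_i) p'0.
  by rewrite coef_deriv coef0 -mulr_natr mulf_eq0 (negbTE (natA_neq0 i)) orbF.
by move: px; rewrite pC hornerC => ->.
Qed.

Section Step.
Variable w : A.
Hypothesis w_neq0 : w != 0.

(** In a tower, [D] maps the rings generated into [w] times themselves, [w]
    being the derivative of the bottom element. So the quotient of [D] by [w]
    is a derivation of these rings, which spares a passage to the fraction
    field. *)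
Definition stable_mod (S : {pred A}) :=
  forall s, s \in S -> exists2 t, t \in S & D s = w * t.

Lemma stable_mod_poly S p : stable_mod S -> p \is a polyOver S ->
  exists q, [/\ q \is a polyOver S, (size q <= size p)%N &
                forall i, D p`_i = w * q`_i].
Proof.
move=> stS /polyOverP pS.
have /choice[t tP] i : exists t, t \in S /\ D p`_i = w * t.
  by have [t] := stS _ (pS i); exists t.
exists (\poly_(i < size p) t i); split; rewrite ?size_poly //.
  apply/polyOverP => i; rewrite coef_poly; case: ifP => _; rewrite ?rpred0 //.
  by have [] := tP i.
move=> i; rewrite coef_poly; case: ltnP => szi; first by have [] := tP i.
by rewrite nth_default // mulr0 (derivation0 derD).
Qed.

Lemma derivation_horner_mod p q v x :
    (forall i, D p`_i = w * q`_i) -> D x = w * v ->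
  D p.[x] = w * (q.[x] + p^`().[x] * v).
Proof.
move=> pq Dx; rewrite derivation_horner // Dx.
have -> : map_poly D p = w *: q.
  by apply/polyP => i; rewrite coefZ coef_map_id0 ?(derivation0 derD).
rewrite hornerZ; ring.
Qed.

Lemma stable_mod_adjoin S x v : stable_mod S ->
  D x = w * v -> v \in adjoin S x -> stable_mod (adjoin S x).
Proof.
move=> stS Dx vS _ /adjoinP[p pS ->]; have [q [qS _ pq]] := stable_mod_poly stS pS.
exists (q.[x] + p^`().[x] * v); last exact: derivation_horner_mod.
rewrite rpredD ?rpredM //; apply/adjoinP; last by exists p^`(); rewrite ?polyOver_deriv.
by exists q.
Qed.

(** With denominators cleared: no fraction [a / b] has a positive integer
    multiple of [y] as its logarithmic derivative. *)
Definition no_logderiv (S : {pred A}) y := forall a b d, a \in S -> b \in S ->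
  a != 0 -> b != 0 -> b * D a - a * D b != d.+1%:R * y * a * b.

(** An exponential over [S] that is algebraic has a power in the fractions of
    [S], up to constants. If [p] is a relation of least degree [d], [a] its
    leading coefficient and [e] the relation obtained by differentiating [p],
    then cancelling the leading term of [e] by a multiple of [p] leaves a
    relation of lower degree, hence 0. Its constant term says that [p`_0 / a]
    has logarithmic derivative [d * (w * u)]; and [p`_0] is nonzero as one
    could otherwise divide by [x]. *)
Lemma transcendental_exp S u x : stable_mod S -> u \in S -> x != 0 ->
    D x = w * u * x -> no_logderiv S (w * u) ->
  transcendental S x.
Proof.
move=> stS uS x0 Dx noS p.
have [n] := ubnP (size p); elim: n p => // n IH p szp pS px; apply/eqP.
apply: contraT => p0.
(* A relation without constant term can be divided by [x]. *)
have [pc0|pc0] := eqVneq p`_0 0.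
  have /factor_theorem[q pq] : root p 0 by rewrite /root horner_coef0 pc0.
  rewrite subr0 in pq; move: (p0); rewrite [in X in X -> _]pq.
  rewrite (IH q) ?mul0r ?eqxx //.
  - have q0 : q != 0 by apply: contraNneq p0 => q0; rewrite pq q0 mul0r.
    by move: szp; rewrite pq size_mulX.
  - apply/polyOverP => i; have /polyOverP/(_ i.+1) := pS.
    by rewrite pq coefMX.
  - by apply/eqP; move/eqP: px; rewrite pq hornerM hornerX mulf_eq0 (negbTE x0) orbF.
have sz1 : (1 < size p)%N.
  rewrite ltnNge; apply: contraNN pc0 => /size1_polyC pC.
  by apply/eqP; rewrite -[RHS]px [in RHS]pC hornerC.
pose d := (size p).-2; have szpd : size p = d.+2 by rewrite /d; case: (size p) sz1 => [|[]].
have [q [qS szq pq]] := stable_mod_poly stS pS.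
pose e := q + u *: ('X * p^`()); pose a := lead_coef p.
have eS : e \is a polyOver S.
  by rewrite rpredD ?polyOverZ ?rpredM ?polyOverX ?polyOver_deriv.
have ecoef i : e`_i = q`_i + p`_i *+ i * u.
  rewrite coefD coefZ coefXM coef_deriv; case: i => [|i] /=.
    by rewrite mulr0n mul0r mulr0.
  by rewrite mulrC.
have ex : e.[x] = 0.
  apply/eqP; have := derivation_horner_mod (p := p) (q := q) (v := u * x) (x := x) pq.
  rewrite mulrA px (derivation0 derD) => /(_ Dx)/esym/eqP.
  rewrite mulf_eq0 (negbTE w_neq0) /= /e hornerD hornerZ hornerM hornerX => /eqP <-.
  by apply/eqP; ring.
have aS : a \in S by apply/polyOverP.
pose r := a *: e - e`_d.+1 *: p.
have r0 : r = 0.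
  apply: IH.
  - apply: (leq_trans _ (szp : (size p <= n)%N)); rewrite szpd ltnS; apply/leq_sizeP => i.
    rewrite leq_eqVlt => /orP[/eqP<-|di].
      by rewrite coefB !coefZ /a lead_coefE szpd mulrC subrr.
    have pi0 : p`_i = 0 by rewrite nth_default ?szpd.
    have qi0 : q`_i = 0 by rewrite nth_default // (leq_trans szq) ?szpd.
    by rewrite coefB !coefZ (ecoef i) pi0 qi0 mul0rn mul0r addr0 !mulr0 subrr.
  - by rewrite /r rpredB ?polyOverZ //; apply/polyOverP.
  - by rewrite hornerD hornerN !hornerZ ex px !mulr0 subrr.
have /negP[] : a * D p`_0 - p`_0 * D a != d.+1%:R * (w * u) * p`_0 * a.
  by apply: noS => //; rewrite ?lead_coef_eq0 //; apply/polyOverP.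
rewrite -subr_eq0; apply/eqP.
have := congr1 (fun s : {poly A} => w * s`_0) r0.
rewrite coefB !coefZ !ecoef coef0 mulr0 mulr0n mul0r addr0 => E; rewrite -[RHS]E.
rewrite /a lead_coefE szpd /= !pq -mulr_natr; ring.
Qed.

(** A degree count in the transcendental element [x]. The hypothesis on [D]
    says that differentiating a polynomial in [x] and dividing by [w] raises
    the degree by less than the degree of [V]. So for [a] and [b] polynomials
    in [x], the quotient of [b * D a - a * D b] by [w] has lower degree than a
    nonzero multiple of [V.[x] * a * b]. *)
Lemma no_logderiv_adjoin S x V : transcendental S x ->
    V \is a polyOver S -> V != 0 ->
    (forall P, P \is a polyOver S -> P != 0 ->
       exists P1, [/\ P1 \is a polyOver S, D P.[x] = w * P1.[x] &
                      ((size P1).+1 < size P + size V)%N]) ->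
  no_logderiv (adjoin S x) (w * V.[x]).
Proof.
move=> trx VS V0 DP _ _ d /adjoinP[P PS ->] /adjoinP[Q QS ->] Px Qx.
have P0 : P != 0 by apply: contraNneq Px => ->; rewrite horner0.
have Q0 : Q != 0 by apply: contraNneq Qx => ->; rewrite horner0.
have [P1 [P1S DP1 szP1]] := DP _ PS P0; have [Q1 [Q1S DQ1 szQ1]] := DP _ QS Q0.
rewrite DP1 DQ1; apply/negP => /eqP E.
pose L := Q * P1 - P * Q1; pose M := d.+1%:R *: (V * P * Q).
have LM : L = M.
  apply/eqP; rewrite -subr_eq0; apply/eqP/trx.
    by rewrite rpredB ?rpredB ?polyOverZ ?rpred_nat ?rpredM.
  apply: (mulfI w_neq0); rewrite mulr0 -(subrr (d.+1%:R * (w * V.[x]) * P.[x] * Q.[x])).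
  rewrite -{1}E !(hornerD, hornerN, hornerZ, hornerM); ring.
have : size L = size M by rewrite LM.
have [sV sP sQ] : [/\ 0 < size V, 0 < size P & 0 < size Q]%N by rewrite !size_poly_gt0.
rewrite /M size_scale // !size_mul ?mulf_neq0 // => szL.
have szQP := size_polyMleq Q P1; have szPQ := size_polyMleq P Q1.
have := size_polyD (Q * P1) (- (P * Q1)); rewrite size_polyN -/L szL leq_max.
move: sV sP sQ szP1 szQ1 szQP szPQ.
move: (size (Q * P1)) (size (P * Q1)) (size V) (size P) (size Q) (size P1) (size Q1).
clear=> ? ? ? ? ? ? ? ? ? ? ? ? ? ? /orP[]; lia.
Qed.

End Step.

(** The bottom element is transcendental because it is not a constant, the
    others by the exponential step, each time with the degree count in the
    element below. Dividing [D] by [w], the derivative of the bottom [z 0] is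
    1, and that of [z n.+1] is linear in [z n.+1]; accordingly the degree count
    is done with [V = 1] at the bottom, where differentiating lowers the
    degree, and with [V = u n *: 'X] above, where it keeps the degree. *)
Lemma transcendental_tower S z :
    {in S, forall s, D s = 0} -> D (z 0%N) != 0 ->
    (forall n, z n.+1 != 0) -> (forall n, D (z n.+1) = z n.+1 * D (z n)) ->
  forall n, transcendental (chain S z n) (z n).
Proof.
move=> DS w0 z0 Dz; set w := D (z 0%N) in w0.
pose u n := \prod_(i < n) z i.+1.
have Dzu n : D (z n) = w * u n.
  elim: n => [|n IH]; first by rewrite /u big_ord0 mulr1.
  by rewrite Dz IH /u big_ord_recr /=; ring.
have uS n : u n \in chain S z n.+1.
  apply: rpred_prod => i _; apply: (sub_chain (m := i.+2)); first by rewrite ltnS.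
  exact: mem_chain.
have st n : stable_mod w (chain S z n).
  elim: n => [|n IH] /=.
    by move=> s sS; exists 0; rewrite ?rpred0 // mulr0 DS.
  exact: (stable_mod_adjoin IH (Dzu n) (uS n)).
elim=> [|n IH]; first exact: transcendental_constants.
apply: (transcendental_exp w0 (st _) (uS n)) => //.
  by rewrite Dz Dzu mulrC.
case: n IH => [|n] IH.
  have -> : w * u 0%N = w * (1 : {poly A}).[z 0%N] by rewrite /u big_ord0 hornerC.
  apply: no_logderiv_adjoin; rewrite ?rpred1 ?oner_neq0 // => P PS P0.
  exists P^`(); split; first exact: polyOver_deriv.
    rewrite derivation_horner //.
    have -> : map_poly D P = 0.
      apply/polyP => i; rewrite coef_map_id0 ?(derivation0 derD) // coef0 DS //.
      exact: polyOverP.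
    by rewrite horner0 add0r mulrC.
  by rewrite size_poly1 addn1 ltnS lt_size_deriv.
have un0 : u n != 0 by apply/prodf_neq0 => i _; exact: z0.
have uE : u n.+1 = (u n *: 'X).[z n.+1] by rewrite /u big_ord_recr /= hornerZ hornerX.
rewrite uE; apply: no_logderiv_adjoin => //.
- by rewrite polyOverZ ?polyOverX.
- by rewrite -size_poly_eq0 size_scale // size_polyX.
move=> P PS P0; have [Q [QS szQ PQ]] := stable_mod_poly (st n.+1) PS.
exists (Q + P^`() * (u n *: 'X)); split.
- by rewrite rpredD ?rpredM ?polyOverZ ?polyOverX ?polyOver_deriv.
- rewrite hornerD hornerM -uE; exact: derivation_horner_mod.
rewrite size_scale // size_polyX addn2 !ltnS.
apply: leq_trans (size_polyD _ _) _; rewrite geq_max szQ -scalerAr size_scale //.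
apply: leq_trans (size_polyMleq _ _) _; rewrite size_polyX addn2 /=.
exact: lt_size_deriv.
Qed.

End Tower.

(** * The integral domain of arithmetic functions *)

Section Arithmetic.
Variable R : realType.
Implicit Types (f g h : arith R) (n : posnat).

Definition vanishes_below (a : nat) f := forall n, (val n < a)%N -> f n = 0.

Lemma vanishes_belowM a b f g :
  vanishes_below a f -> vanishes_below b g -> vanishes_below (a * b) (f * g).
Proof.
move=> fa gb n nab; rewrite arithME big_seq big1 // => d.
rewrite -dvdn_divisors ?(valP n) // => /dvdnP[e ne].
have n0 := valP n; rewrite ne muln_gt0 in n0; case/andP: n0 => e0 d0.
have [da|ad] := ltnP d a; first by rewrite fa ?mul0r // pnK.
rewrite gb ?mulr0 // ne mulnK // pnK //.
by rewrite -(ltn_pmul2l d0) [(d * e)%N]mulnC -ne (leq_trans nab) // leq_mul2r ad orbT.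
Qed.

(** The leading term of a product: in a factorization [d * e = a * b] other
    than [d = a], [e = b], either [d < a] or [e < b]. *)
Lemma mul_lead a b f g : (0 < a)%N -> (0 < b)%N ->
    vanishes_below a f -> vanishes_below b g ->
  (f * g) (pn (a * b)) = f (pn a) * g (pn b).
Proof.
move=> a0 b0 fa gb; have ab0 : (0 < a * b)%N by rewrite muln_gt0 a0.
rewrite arithME pnK // (bigD1_seq a) ?divisors_uniq //=; last first.
  by rewrite -dvdn_divisors // dvdn_mulr.
rewrite mulKn // big_seq_cond big1 ?addr0 // => d.
rewrite -dvdn_divisors // => /andP[/dvdnP[e abe] da].
have /andP[e0 d0] : (0 < e)%N && (0 < d)%N by rewrite -muln_gt0 -abe.
have [d_lt|] := ltnP d a; first by rewrite fa ?mul0r // pnK.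
rewrite leq_eqVlt eq_sym (negbTE da) /= => a_lt.
rewrite gb ?mulr0 // abe mulnK // pnK //.
by rewrite -(ltn_pmul2l d0) [(d * e)%N]mulnC -abe ltn_pmul2r.
Qed.

Lemma vorder_gt0 f : f != 0 -> (0 < vorder f)%N.
Proof. by rewrite lt0n vorder_eq0. Qed.

Lemma vorder_neq0 f : f != 0 -> f (pn (vorder f)) != 0.
Proof. by rewrite -vorder_eq0; case: vorderP. Qed.

Lemma vanishes_below_vorder f : vanishes_below (vorder f) f.
Proof.
move=> n; case: vorderP => [-> //|m m0 _ fm nm].
by rewrite -(pn_val n) fm // nm (valP n).
Qed.

Fact arith_integral f g : f * g = 0 -> (f == 0) || (g == 0).
Proof.
move=> fg0; apply: contraT; rewrite negb_or => /andP[f0 g0].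
have := mul_lead (vorder_gt0 f0) (vorder_gt0 g0)
  (@vanishes_below_vorder f) (@vanishes_below_vorder g).
rewrite fg0 => /esym/eqP; rewrite mulf_eq0.
by rewrite (negbTE (vorder_neq0 f0)) (negbTE (vorder_neq0 g0)).
Qed.

Definition arith_unit : pred (arith R) := fun f => `[< exists g, g * f = 1 >].
Definition arith_inv f : arith R :=
  if pselect (exists g, g * f = 1) is left ex then projT1 (cid ex) else f.

Fact arith_mulVr : {in arith_unit, left_inverse 1 arith_inv *%R}.
Proof.
by move=> f /asboolP ex; rewrite /arith_inv; case: pselect => // ?; case: cid.
Qed.

Fact arith_unitPl f g : g * f = 1 -> arith_unit f.
Proof. by move=> gf; apply/asboolP; exists g. Qed.

Fact arith_inv_out : {in [predC arith_unit], arith_inv =1 id}.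
Proof.
by move=> f /asboolP nex; rewrite /arith_inv; case: pselect.
Qed.

HB.instance Definition _ := GRing.ComNzRing_hasMulInverse.Build (arith R)
  arith_mulVr arith_unitPl arith_inv_out.
HB.instance Definition _ :=
  GRing.ComUnitRing_isIntegral.Build (arith R) arith_integral.

Lemma arith_pchar0 : [pchar (arith R)] =i pred0.
Proof.
apply/pcharf0P => n; apply/eqP/eqP => [|-> //].
move/(congr1 (fun f : arith R => f pone)) => /eqP.
have -> : (n%:R : arith R) pone = n%:R.
  by elim: n => // n IH; rewrite -!natr1 arithDE IH.
by rewrite arith0E pnatr_eq0 => /eqP.
Qed.

End Arithmetic.

(** * Weight derivations and the exponential *)

Definition completely_additive (V : zmodType) (w : nat -> V) :=
  forall m n, (0 < m)%N -> (0 < n)%N -> w (m * n)%N = w m + w n.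

Lemma completely_additive1 (V : zmodType) (w : nat -> V) :
  completely_additive w -> w 1%N = 0.
Proof. by move=> wM; apply: (addrI (w 1%N)); rewrite -wM // addr0. Qed.

Section WeightDerivations.
Variable R : realType.
Implicit Types (f g h : arith R) (n : posnat).

Definition weightD (w : nat -> R[i]) f : arith R := Arith (fun n => w (val n) * f n).

Lemma weightD_derivation w : completely_additive w -> derivation (weightD w).
Proof.
move=> wM; split=> f g; apply: arithP => n.
  by rewrite /= mulrDr.
rewrite arithDE !arithME /= mulr_sumr -big_split big_seq [RHS]big_seq.
apply: eq_bigr => d; rewrite -dvdn_divisors ?(valP n) // => dn /=.
have d0 := dvdn_gt0 (valP n) dn.
have nd0 : (0 < val n %/ d)%N by rewrite divn_gt0 // dvdn_leq ?(valP n).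
rewrite !pnK // -{1}(divnK dn) mulnC wM //; ring.
Qed.

Lemma weightDZ w c f : weightD w (c *: f) = c *: weightD w f.
Proof. by apply: arithP => n; rewrite /= mulrCA. Qed.

Lemma weightD_scalar w c : completely_additive w -> weightD w (c%:A) = 0.
Proof.
move=> wM; apply: arithP => n; rewrite weightDZ arithZE /=.
case: eqP => [->|_]; first by rewrite (completely_additive1 wM : w (val pone) = 0) mul0r mulr0.
by rewrite !mulr0.
Qed.

Definition exp_sum f N := \sum_(k < N) (k`!%:R^-1 : R[i]) *: f ^+ k.

Lemma exprn_vanish f k : f pone = 0 -> vanishes_below (2 ^ k) (f ^+ k).
Proof.
move=> f1; elim: k => [|k IH].
  by move=> n; rewrite ltnS leqn0 => /eqP n0; have := valP n; rewrite n0.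
rewrite expnS exprS; apply: vanishes_belowM => // n n2.
suff -> : n = pone by [].
by apply: val_inj; apply/eqP; rewrite eqn_leq -ltnS n2 (valP n).
Qed.

(** Since [f ^+ k] vanishes below [2 ^ k] when [f pone = 0], at [n] only the
    terms [k < n] of the exponential series contribute. So the limit in the
    metric is the pointwise limit, and is attained at each [n]. *)
Lemma exp_sum_stable f n N : f pone = 0 -> (val n <= N)%N ->
  exp_sum f N n = exp_sum f (val n) n.
Proof.
move=> f1 /subnK <-; elim: (N - val n)%N => // k IH.
rewrite /exp_sum addSn big_ord_recr arithDE -/(exp_sum _ _) IH /=.
rewrite exprn_vanish ?mulr0 ?addr0 //.
by rewrite (leq_ltn_trans _ (ltn_expl _ _)) // leq_addl.
Qed.

Definition exp_series f : arith R := Arith (fun n => exp_sum f (val n) n).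

Lemma limn_exp_series f : f pone = 0 ->
  limn (series (fun k => (k`!%:R^-1 : R[i]) *: f ^+ k)) = exp_series f.
Proof.
move=> f1; apply: cvg_lim; first exact: (@metric_hausdorff R).
apply/cvg_ballP => e e0; near=> N.
rewrite ballEmdist /=.
change (adist (exp_series f) (series (fun k => (k`!%:R^-1 : R[i]) *: f ^+ k) N) < e).
rewrite /series /= big_mkord -/(exp_sum f N).
rewrite /adist /anorm; case: vorderP => [_|n n0 dn _]; first by rewrite invr0.
have Nn : (N < n)%N.
  rewrite ltnNge; apply: contraNN dn => nN.
  by rewrite arithBE (exp_sum_stable _ (N := N)) ?subrr // pnK.
have N0 : (0 < N)%N by near: N; exact: nbhs_infty_gt.
have eN : e^-1 <= N%:R by near: N; exact: nbhs_infty_ger.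
rewrite invf_plt ?posrE ?ltr0n //.
by rewrite (le_lt_trans eN) // ltr_nat.
Unshelve. all: by end_near. Qed.

Lemma ExpE f : Exp f = cexp (f pone) *: exp_series (f - (f pone)%:A).
Proof.
rewrite /Exp limn_exp_series // arithBE arithZE arith1E eqxx mulr1.
exact: subrr.
Qed.

(** The derivative of the partial sum of length [N.+1] is the product of the
    one of length [N] by the derivative of [f]. At a given [n], and at its
    divisors, these sums have reached their limits as soon as [N >= n]. *)
Lemma weightD_exp_series w f : completely_additive w -> f pone = 0 ->
  weightD w (exp_series f) = exp_series f * weightD w f.
Proof.
move=> wM f1; have [wD wL] := weightD_derivation wM.
have powS k : weightD w (f ^+ k.+1) = k.+1%:R *: f ^+ k * weightD w f.
  elim: k => [|k IH]; first by rewrite expr0 scale1r mul1r expr1.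
  rewrite exprS wL IH -[in RHS]natr1 scalerDl scale1r mulrDl addrC mulrA.
  by rewrite -scalerAr -exprS [f ^+ k.+1 * _]mulrC.
have sumS N : weightD w (exp_sum f N.+1) = exp_sum f N * weightD w f.
  elim: N => [|N IH].
    by rewrite /exp_sum big_ord1 big_ord0 mul0r expr0 weightD_scalar.
  rewrite /exp_sum big_ord_recr wD -/(exp_sum _ _) IH weightDZ powS.
  rewrite [in RHS]/exp_sum big_ord_recr mulrDl /=; congr (_ + _).
  rewrite -!scalerAl scalerA; congr (_ *: _).
  by rewrite factS natrM invfM mulrAC mulVf ?mul1r // pnatr_eq0.
apply: arithP => n; rewrite /= -(exp_sum_stable f1 (leqnSn _)).
transitivity (weightD w (exp_sum f (val n).+1) n); first by [].
rewrite sumS !arithME big_seq [RHS]big_seq; apply: eq_bigr => d.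
rewrite -dvdn_divisors ?(valP n) // => dn; congr (_ * _).
by rewrite /= exp_sum_stable // pnK ?(dvdn_gt0 (valP n) dn) // dvdn_leq // (valP n).
Qed.

Lemma weightD_Exp w f : completely_additive w ->
  weightD w (Exp f) = Exp f * weightD w f.
Proof.
move=> wM; have [wD _] := weightD_derivation wM.
rewrite ExpE weightDZ weightD_exp_series //; last first.
  by rewrite arithBE arithZE arith1E eqxx mulr1 subrr.
rewrite scalerAl; congr (_ * _).
rewrite wD (derivation_opp (weightD_derivation wM)) weightD_scalar //.
by rewrite oppr0 addr0.
Qed.

Lemma cexp_neq0 (z : R[i]) : cexp z != 0.
Proof.
apply: mulf_neq0; rewrite eq_complex /= negb_and.
  by rewrite gt_eqF ?expR_gt0.
apply: contraT; rewrite negb_or !negbK => /andP[/eqP c0 /eqP s0].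
by have /eqP := cos2Dsin2 (complex.Im z); rewrite c0 s0 expr0n addr0 eq_sym oner_eq0.
Qed.

Lemma Exp_neq0 f : Exp f != 0.
Proof.
apply/eqP => /(congr1 (fun g : arith R => g pone)) /eqP; apply/negP.
rewrite ExpE arithZE arith0E mulf_neq0 ?cexp_neq0 //.
by rewrite /= /exp_sum big_ord1 expr0 arithZE arith1E fact0 eqxx mulr1 invr1 oner_neq0.
Qed.

End WeightDerivations.

(** * Weights dual to multiplicatively independent integers *)

Section DualWeights.
Variable N : nat.
Variable a : 'I_N -> nat.
Hypothesis a_gt0 : forall i, (0 < a i)%N.

Definition exponents_independent := forall k : 'I_N -> int,
  \prod_i ((a i)%:R : rat) ^ k i = 1 -> forall i, k i = 0.

Lemma logn_prod (I : Type) (r : seq I) (F : I -> nat) p :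
  (forall i, 0 < F i)%N -> logn p (\prod_(i <- r) F i) = (\sum_(i <- r) logn p (F i))%N.
Proof.
move=> F0; elim: r => [|i r IH]; first by rewrite !big_nil logn1.
by rewrite !big_cons lognM ?IH // prodn_gt0.
Qed.

(** Unique factorization, after moving the factors with negative exponents to
    the other side. *)
Lemma prod_exp_eq1 (k : 'I_N -> int) :
    (forall p, prime p -> \sum_i k i * (logn p (a i))%:Z = 0) ->
  \prod_i ((a i)%:R : rat) ^ k i = 1.
Proof.
move=> klog.
pose pos i := if k i is Posz n then n else 0%N.
pose neg i := if k i is Negz n then n.+1 else 0%N.
have kE i : k i = (pos i)%:Z - (neg i)%:Z by rewrite /pos /neg; case: (k i) => n; lia.
have aQ0 i : (a i)%:R != 0 :> rat by rewrite pnatr_eq0 -lt0n.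
have PN : (\prod_i a i ^ pos i = \prod_i a i ^ neg i)%N.
  have gt0 (e : 'I_N -> nat) i : (0 < a i ^ e i)%N by rewrite expn_gt0 a_gt0.
  apply: eqn_from_log; rewrite ?prodn_gt0 // => p.
  have [pr|npr] := boolP (prime p); last by rewrite lognE [RHS]lognE (negbTE npr).
  rewrite !logn_prod //; apply/eqP; rewrite -eqz_nat -subr_eq0 -[X in _ == X](klog p pr).
  rewrite !(big_morph Posz PoszD (erefl 0%:Z)) -sumrB; apply/eqP/eq_bigr => i _.
  by rewrite !lognX !PoszM kE mulrBl.
under eq_bigr do rewrite kE expfzDr // -exprnP -invr_expz -exprnP -!natrX.
rewrite big_split /= -natr_prod prodfV -natr_prod PN mulfV //.
by rewrite pnatr_eq0 -lt0n prodn_gt0 // => i; rewrite expn_gt0 a_gt0.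
Qed.

(** A linear relation between the rows, multiplied by a common denominator, is
    a multiplicative relation between the [a i]. The primes beyond the largest
    [a i] divide none of them, which makes the matrix finite. *)
Lemma logn_matrix_row_free : exponents_independent ->
  row_free (\matrix_(i < N, p < (\max_i a i).+1) (logn p (a i))%:R : 'M[rat]_(_, _)).
Proof.
move=> ind; apply: inj_row_free => v v0.
pose k i := numq (v 0 i) * \prod_(j | j != i) denq (v 0 j).
pose d : rat := (\prod_j denq (v 0 j))%:~R.
have kE i : (k i)%:~R = v 0 i * d :> rat.
  rewrite /d (bigD1 i) //= !rmorphM /= mulrA; congr (_ * _).
  by rewrite -{2}[v 0 i]divq_num_den mulfVK // intr_eq0 denq_neq0.
have d0 : d != 0 by rewrite intr_eq0; apply/prodf_neq0 => j _; exact: denq_neq0.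
have k0 : forall i, k i = 0.
  apply/ind/prod_exp_eq1 => p pr; apply/eqP; rewrite -(intr_eq0 rat) rmorph_sum /=.
  have [pM|Mp] := ltnP p (\max_i a i).+1; last first.
    apply/eqP/big1 => i _; rewrite ltn_log0 ?mulr0 //.
    exact: leq_ltn_trans (leq_bigmax i) Mp.
  have /rowP/(_ (Ordinal pM)) := v0; rewrite !mxE => vp.
  apply/eqP; rewrite -[RHS](mul0r d) -[in RHS]vp mulr_suml; apply: eq_bigr => i _.
  by rewrite mxE rmorphM /= kE mulrAC -pmulrn.
apply/rowP => i; rewrite mxE; apply: (mulIf d0).
by rewrite mul0r -kE k0.
Qed.

(** The weights are the combinations of [p]-adic valuations given by a right
    inverse of the matrix of valuations. *)
Lemma dual_weights (C : numFieldType) : exponents_independent ->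
  exists w : 'I_N -> nat -> C,
    (forall l, completely_additive (w l)) /\
    forall i l, w l (a i) = (i == l)%:R.
Proof.
move=> /logn_matrix_row_free/row_freeP[B VB].
exists (fun l n => \sum_p ratr (B p l) * (logn p n)%:R); split.
  move=> l m n m0 n0; rewrite -big_split; apply: eq_bigr => p _.
  by rewrite lognM // natrD mulrDr.
move=> i l; have /matrixP/(_ i l) := VB; rewrite !mxE => E.
have -> : (i == l)%:R = ratr (i == l)%:R :> C by rewrite ratr_nat.
rewrite -E rmorph_sum; apply: eq_bigr => p _.
by rewrite mxE rmorphM /= ratr_nat mulrC.
Qed.

End DualWeights.

(** * Derivations dual to arithmetic functions *)

Section DualDerivations.
Variable R : realType.
Implicit Types (f g h : arith R).

Lemma prod_lead (I : Type) (r : seq I) (a : I -> nat) (F : I -> arith R) :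
    (forall i, 0 < a i)%N -> (forall i, vanishes_below (a i) (F i)) ->
  (\prod_(i <- r) F i) (pn (\prod_(i <- r) a i)) = \prod_(i <- r) F i (pn (a i)).
Proof.
move=> a0 Fa.
have low s : vanishes_below (\prod_(i <- s) a i) (\prod_(i <- s) F i).
  elim: s => [|i s IH]; last by rewrite !big_cons; exact: vanishes_belowM.
  by move=> n; rewrite big_nil ltnS leqn0 => /eqP n0; have := valP n; rewrite n0.
elim: r => [|i r IH]; first by rewrite !big_nil arith1E -[pn 1]/(pn (val pone)) pn_val eqxx.
by rewrite !big_cons mul_lead ?IH // prodn_gt0.
Qed.

Lemma arith_sumE (I : Type) (r : seq I) (F : I -> arith R) n :
  (\sum_(i <- r) F i) n = \sum_(i <- r) F i n.
Proof. by elim/big_rec2: _ => // i x y _ <-. Qed.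

(** Every continuous linear derivation is one; stating the two consequences
    avoids continuity and is stable under combinations with coefficients. *)
Definition exp_derivation (D : arith R -> arith R) :=
  [/\ derivation D, forall c, D c%:A = 0 & forall f, D (Exp f) = Exp f * D f].

Lemma exp_derivation_comb N (w : 'I_N -> nat -> R[i]) (c : 'I_N -> arith R) :
    (forall l, completely_additive (w l)) ->
  exp_derivation (fun h => \sum_l weightD (w l) h * c l).
Proof.
move=> wM; split; [split|..] => [f g|f g|x|f].
- rewrite -big_split; apply: eq_bigr => l _ /=.
  by rewrite (weightD_derivation (wM l)).1 mulrDl.
- rewrite mulr_suml mulr_sumr -big_split; apply: eq_bigr => l _ /=.
  rewrite (weightD_derivation (wM l)).2; ring.
- by rewrite big1 // => l _; rewrite weightD_scalar // mul0r.
- by rewrite mulr_sumr; apply: eq_bigr => l _; rewrite weightD_Exp // mulrA.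
Qed.

(** With the weights dual to the orders, the leading coefficient matrix of the
    Jacobian [J] is diagonal, so the determinant of [J] has the product of the
    leading coefficients of the [f j] as its coefficient at the product of the
    orders. The derivation attached to [i] replaces row [i] of [J] by the
    derivatives of its argument and takes the determinant, expanded along that
    row: it vanishes at [f j] by the equality of two rows, and takes the value
    [\det J] at [f i]. *)
Lemma dual_derivations N (f : 'I_N -> arith R) :
    (forall i, f i != 0) -> exponents_independent (fun i => vorder (f i)) ->
  forall i, exists D, [/\ exp_derivation D, D (f i) != 0 &
                          forall j, j != i -> D (f j) = 0].
Proof.
move=> f0 ind i; pose a j := vorder (f j).
have a0 j : (0 < a j)%N by exact: vorder_gt0.
have [w [wM wa]] := dual_weights a0 (R[i]) ind.
pose J := \matrix_(j, l) weightD (w l) (f j).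
have JE j : \sum_l weightD (w l) (f j) * cofactor J i l = (j == i)%:R * \det J.
  (* Entry [(j, i)] of [J *m \adj J = (\det J)%:M]. *)
  have /matrixP/(_ j i) := mul_mx_adj J; rewrite !mxE => E.
  rewrite mulr_natl -E; apply: eq_bigr => l _; rewrite !mxE //.
exists (fun h => \sum_l weightD (w l) h * cofactor J i l); split.
- exact: exp_derivation_comb.
- rewrite JE eqxx mul1r; apply/eqP.
  move=> /(congr1 (fun h : arith R => h (pn (\prod_j a j)))) /eqP; apply/negP.
  have JV j l : vanishes_below (a j) (J j l).
    by move=> n nj; rewrite mxE /= vanishes_below_vorder ?mulr0.
  have JL j l : J j l (pn (a j)) = (j == l)%:R * f j (pn (a j)).
    by rewrite mxE /= pnK // wa.
  have term (s : 'S_N) : ((-1) ^+ s * \prod_j J j (s j)) (pn (\prod_j a j)) =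
      if s == 1%g then \prod_j f j (pn (a j)) else 0.
    case: eqVneq => [->|s1].
      rewrite odd_perm1 expr0 mul1r prod_lead //; apply: eq_bigr => j _.
      by rewrite JL perm1 eqxx mul1r.
    have [j sj] : exists j, s j != j.
      apply/existsP; apply: contraNT s1; rewrite negb_exists => /forallP sj.
      by apply/eqP/permP => j; rewrite perm1; apply/eqP; rewrite -[_ == _]negbK sj.
    have p0 : (\prod_j J j (s j)) (pn (\prod_j a j)) = 0.
      by rewrite prod_lead // (bigD1 j) //= JL eq_sym (negbTE sj) !mul0r.
    by rewrite mulr_sign; case: (odd_perm s); rewrite ?arithNE p0 ?oppr0.
  rewrite /determinant arith_sumE (eq_bigr _ (fun s _ => term s)) -big_mkcond.
  rewrite big_pred1_eq; apply/prodf_neq0 => j _; exact: vorder_neq0.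
- by move=> j ji; rewrite JE (negbTE ji) mul0r.
Qed.

End DualDerivations.

(** * Iterated exponentials *)

Section IteratedExponentials.
Variable R : realType.
Implicit Types (f g : arith R) (W : set (arith R)).

Lemma exp_derivation_iter0 D f n :
  exp_derivation D -> D f = 0 -> D (iter n Exp f) = 0.
Proof.
case=> _ _ DE Df; elim: n => //= n IH.
by rewrite DE IH mulr0.
Qed.

(** [y] lists the first [M] terms of the tower over [F 0], then those of the
    tower over [F 1], and so on. The derivation attached to [i] kills all that
    comes before the tower over [F i]. *)
Lemma transcendental_towers N (F : 'I_N -> arith R) M (y : nat -> arith R) :
    (forall i, F i != 0) -> exponents_independent (fun i => vorder (F i)) ->
    (forall (i : 'I_N) j, (j < M)%N -> y (i * M + j)%N = iter j Exp (F i)) ->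
  forall (i : 'I_N) j, (j < M)%N ->
    transcendental (chain (@scalars _ (arith R)) y (i * M + j)) (y (i * M + j)%N).
Proof.
move=> F0 ind yE i j jM.
have [D [[derD Dc DE] DFi DFj]] := dual_derivations F0 ind i.
rewrite chainD (@eq_chain _ _ _ (fun s => iter s Exp (F i))) => [|s sj]; last first.
  by rewrite yE // (ltn_trans sj).
rewrite yE //.
apply: (@transcendental_tower _ D (@arith_pchar0 R) derD _ (fun s => iter s Exp (F i))) => //=.
- apply: chain_constants => // [_ /scalarsP[c ->] //|s si].
  have M0 : (0 < M)%N by case: M jM {yE si}.
  have sN : (s %/ M < N)%N.
    rewrite ltn_divLR // (leq_trans si) // leq_mul2r orbC ltnW ?ltn_ord //.
  rewrite (divn_eq s M) -[(s %/ M)%N]/(val (Ordinal sN)) yE ?ltn_mod //.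
  apply: exp_derivation_iter0 => //; apply: DFj.
  by rewrite -val_eqE /= ltn_eqF // ltn_divLR.
- by move=> s; exact: Exp_neq0.
Qed.

Lemma vorder_neq1 W f : mult_indep W (@vorder R) -> W f -> vorder f != 1%N.
Proof.
move=> ind Wf; apply/eqP => f1.
have inj : injective (fun _ : 'I_1 => f) by move=> i j _; rewrite !ord1.
have := ind 1%N _ (fun=> 1) inj (fun=> Wf); rewrite big_ord1 f1 exp1rz.
by move=> /(_ erefl ord0).
Qed.

Lemma indep_pone_eq0 W f : (forall g, W g -> g != 0) -> mult_indep W (@vorder R) ->
  W f -> f pone = 0.
Proof.
move=> W0 ind Wf; apply: (@vanishes_below_vorder _ f) => /=.
by rewrite ltn_neqAle eq_sym (vorder_neq1 ind Wf) vorder_gt0 ?W0.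
Qed.

Lemma kmax_eq0 W f : W f -> f pone = 0 -> kmax W = 0%N.
Proof.
move=> Wf f1; rewrite /kmax; case: xgetP => // k _ [kW _].
case: k kW => // k /(_ f Wf 0%N isT); rewrite /arith_pos /= f1.
by rewrite ltxx.
Qed.

Lemma ExpstarP W g : (forall f, W f -> f != 0) -> mult_indep W (@vorder R) ->
  Expstar W g -> exists f n, W f /\ g = iter n Exp f.
Proof.
move=> W0 ind [f [m [Wf]]].
rewrite (kmax_eq0 Wf (indep_pone_eq0 W0 ind Wf)) oppr0.
by case: m => // n _ ->; exists f, n.
Qed.

End IteratedExponentials.

Theorem theorem4p10 (R : realType) (W : set (arith R))
  (W_neq0 : forall f, W f -> f != 0)
  (W_indep : mult_indep W (@vorder R)) :
  alg_indep (Expstar W).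
Proof.
move=> n x p x_inj xW px0.
have /choice[f /choice[m fmP]] j : exists f n, W f /\ x j = iter n Exp f.
  exact: ExpstarP.
(* [s] lists the distinct members of [W] involved, and [M] bounds the number of
   exponentials applied to them. *)
pose s := undup [seq f j | j <- enum 'I_n]; pose N := size s.
pose M := (\max_j m j).+1.
have mM j : (m j < M)%N by rewrite ltnS leq_bigmax.
have fs j : f j \in s by rewrite mem_undup; apply/map_f; rewrite mem_enum.
pose F (i : 'I_N) := nth 0 s i.
have FW i : W (F i).
  have : F i \in s by rewrite mem_nth.
  by rewrite mem_undup => /mapP[j _ ->]; exact: (fmP j).1.
have F_inj : injective F.
  by move=> i i' /eqP; rewrite nth_uniq ?undup_uniq // => /eqP/val_inj.
have F0 i : F i != 0 by exact: W_neq0.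
have F_ind : exponents_independent (fun i => vorder (F i)).
  by move=> k; apply: W_indep.
pose y t := iter (t %% M) Exp (nth 0 s (t %/ M)).
have yE (i : nat) j : (j < M)%N -> y (i * M + j)%N = iter j Exp (nth 0 s i).
  by move=> jM; rewrite /y modnMDl modn_small // divnMDl // divn_small ?addn0.
pose r j := (index (f j) s * M + m j)%N.
have xE j : x j = y (r j) by rewrite (fmP j).2 /r yE ?nth_index.
apply: (@alg_indep_filtration _ _ (chain (@scalars _ (arith R)) y) _ _ n x r) => //.
- move=> t c; apply: (@sub_chain _ _ _ 0%N) => //=.
  by apply/scalarsP; exists c.
- by move=> t; apply: sub_chain.
- by move=> j j' rjj'; apply: x_inj; rewrite !xE rjj'.
- by move=> j; rewrite xE; exact: mem_chain.
- move=> j; rewrite xE /r.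
  have idx : (index (f j) s < N)%N by rewrite index_mem.
  apply: (@transcendental_towers _ N F M y F0 F_ind _ (Ordinal idx)) => // i k kM.
  exact: yE.
Qed.
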